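(* Let $(p_k,P_k)_{k=1}^n$ be a weighted spherical $2$-design in $\mathbb C^d$, and let $\mathcal M$ be the map associated with the POVM $(M_k)_{k=1}^n$, $M_k=d\,p_kP_k$. Then $\lambda(\mathcal M)\ge\frac12\frac1{d+1}$; that is, for every traceless Hermitian operator $\xi$ on $\mathbb C^d$, $$\|\mathcal M(\xi)\|_1\ \ge\ \frac12\,\frac1{d+1}\,\|\xi\|_1 .$$
   Context: A weighted spherical $2$-design is a family of rank-one projectors $P_1,\dots,P_n$ on $\mathbb C^d$ together with probabilities $p_k\ge0$, $\sum_kp_k=1$, such that $\sum_{k=1}^np_k\,P_k\otimes P_k=\frac1{d(d+1)}(\mathbb 1+F)$, where $F$ is the swap operator on $\mathbb C^d\otimes\mathbb C^d$; then $(d\,p_kP_k)_k$ is a POVM. The associated map is $\mathcal M(\xi)=\sum_{k=1}^n|k\rangle\langle k|\operatorname{Tr}(\xi M_k)$, so $\|\mathcal M(\xi)\|_1=\sum_k|\operatorname{Tr}(\xi M_k)|$. $\|\cdot\|_1$ is the trace norm. $\lambda(\mathcal M)$ is the largest real number $\lambda$ with $\lambda\|\xi\|_1\le\|\mathcal M(\xi)\|_1$ for all traceless Hermitian $\xi$. *)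

(* Defs.v *)
From mathcomp Require Import all_boot all_order all_algebra.
From mathcomp Require Import sesquilinear spectral.
From mathcomp Require Import complex mxtens.
From mathcomp Require Import classical_sets reals ereal.

Set Implicit Arguments.
Unset Strict Implicit.
Unset Printing Implicit Defensive.

Import Order.TTheory GRing.Theory Num.Theory.
Local Open Scope ring_scope.
Local Open Scope complex_scope.
Local Open Scope sesquilinear_scope.

(* Operators on C^d are matrices 'M[R[i]]_d with R : realType, and operators on
   C^d (x) C^d are matrices 'M[R[i]]_(d * d), with A *t B the Kronecker
   product. *)

(* Square root by spectral calculus; meaningful for positive semidefinite A. *)
Definition sqrtmx (R : realType) n (A : 'M[R[i]]_n) : 'M[R[i]]_n :=
  invmx (spectralmx A) *m diag_mx (map_mx sqrtC (spectral_diag A))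
  *m spectralmx A.

(* The trace is a nonnegative element of R[i]; Re only changes its type. *)
Definition trnorm (R : realType) n (A : 'M[R[i]]_n) : R :=
  complex.Re (\tr (sqrtmx (A ^t* *m A))).

Definition rank1_projector (R : realType) d (P : 'M[R[i]]_d) : Prop :=
  [/\ P \is hermsymmx, P *m P = P & \rank P = 1%N].

(* sum_(i, j) |i><j| (x) |j><i|; see swapmx_tens. *)
Definition swapmx (R : realType) d : 'M[R[i]]_(d * d) :=
  \sum_(i < d) \sum_(j < d) delta_mx i j *t delta_mx j i.

Record weighted_2design (R : realType) d n (p : 'I_n -> R)
    (P : 'I_n -> 'M[R[i]]_d) : Prop := Weighted2Design {
  w2d_ge0 : forall k, 0 <= p k;
  w2d_sum : \sum_(k < n) p k = 1;
  w2d_proj : forall k, rank1_projector (P k);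
  w2d_tens : \sum_(k < n) (p k)%:C *: (P k *t P k) =
             (d%:R * d.+1%:R)^-1 *: (1%:M + swapmx R d)
}.

Definition design_povm (R : realType) d n (p : 'I_n -> R)
    (P : 'I_n -> 'M[R[i]]_d) (k : 'I_n) : 'M[R[i]]_d :=
  (d%:R * (p k)%:C) *: P k.

Definition measurement (R : realType) d n (M : 'I_n -> 'M[R[i]]_d)
    (xi : 'M[R[i]]_d) : 'M[R[i]]_n :=
  \sum_(k < n) \tr (xi *m M k) *: delta_mx k k.

Definition lambda_set (R : realType) d n (f : 'M[R[i]]_d -> 'M[R[i]]_n) :
    set R :=
  [set l | forall xi : 'M[R[i]]_d, xi \is hermsymmx -> \tr xi = 0 ->
     l * trnorm xi <= trnorm (f xi)].

(* Extended-real valued because for d <= 1 only xi = 0 is traceless and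
   Hermitian, so that every real l is admissible and the value is +oo.  A finite
   value is the largest admissible real: see lambda_largest. *)
Definition lambda (R : realType) d n (f : 'M[R[i]]_d -> 'M[R[i]]_n) : \bar R :=
  ereal_sup [set l%:E | l in lambda_set f].

Lemma swapmx_tens (R : realType) d (u v : 'cV[R[i]]_d) :
  swapmx R d *m (u *t v) = v *t u.
Proof.
have dE (i j x : 'I_d) (w : 'cV[R[i]]_d) :
    (delta_mx i j *m w) x 0 = (x == i)%:R * w j 0.
  rewrite mxE (bigD1 j) //= big1 ?addr0 ?mxE ?eqxx ?andbT // => k /negPf kj.
  by rewrite mxE kj andbF mul0r.
apply/matrixP => r c; case: (mxtens_indexP r) => a b.
case: (mxtens_indexP c) => o o'; rewrite tensmxE (ord1 o) (ord1 o').
have tE i j : ((delta_mx i j *t delta_mx j i) *m (u *t v))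
    (mxtens_index (a, b)) (mxtens_index (0, 0)) =
    (a == i)%:R * u j 0 * ((b == j)%:R * v i 0).
  by rewrite -[X in _ *m X]/(u *t v) tensmx_mul tensmxE !dE.
rewrite mulmx_suml summxE (bigD1 a) //= [X in _ + X]big1 ?addr0; last first.
  move=> i /negPf ia; rewrite mulmx_suml summxE big1 // => j _.
  by rewrite tE eq_sym ia !mul0r.
rewrite mulmx_suml summxE (bigD1 b) //= [X in _ + X]big1 ?addr0; last first.
  by move=> j /negPf jb; rewrite tE [b == j]eq_sym jb mul0r mulr0.
by rewrite tE !eqxx !mul1r mulrC.
Qed.

Lemma spectral_diag_gram_ge0 (R : realType) n (A : 'M[R[i]]_n) k :
  0 <= spectral_diag (A ^t* *m A) 0 k.
Proof.
set B := A ^t* *m A; set P := spectralmx B.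
have Bn : B \is normalmx.
  apply: hermitian_normalmx; apply/is_hermitianmxP; rewrite expr0 scale1r.
  by rewrite /B trmx_mul map_mxM /= trmxCK.
have Pu : P \is unitarymx by exact: spectral_unitarymx.
have Punit : P \in unitmx by exact: spectral_unit.
have : diag_mx (spectral_diag B) = (A *m P ^t*) ^t* *m (A *m P ^t*).
  have /orthomx_spectralP BE := Bn.
  rewrite trmx_mul map_mxM /= trmxCK mulmxA -(mulmxA P) -/B.
  by rewrite {2}BE -/P -invmx_unitary // !mulmxA mulmxV // mul1mx mulmxK.
move=> /matrixP/(_ k k); rewrite !mxE eqxx mulr1n => ->.
by apply: sumr_ge0 => j _; rewrite !mxE mulrC mul_conjC_ge0.
Qed.

Lemma trnorm_ge0 (R : realType) n (A : 'M[R[i]]_n) : 0 <= trnorm A.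
Proof.
rewrite /trnorm /sqrtmx mxtrace_mulC mulmxA mulmxV ?spectral_unit // mul1mx.
have : 0 <= \tr (diag_mx (map_mx sqrtC (spectral_diag (A ^t* *m A)))).
  rewrite mxtrace_diag; apply: sumr_ge0 => k _.
  by rewrite mxE sqrtC_ge0 spectral_diag_gram_ge0.
by rewrite lecE => /andP[].
Qed.

Lemma lambda_largest (R : realType) d n (f : 'M[R[i]]_d -> 'M[R[i]]_n)
    (l : R) :
  lambda f = l%:E <->
  lambda_set f l /\ (forall l', lambda_set f l' -> l' <= l).
Proof.
split=> [fl|[lf lub]]; last first.
  apply/eqP; rewrite eq_le; apply/andP; split.
    by apply: ge_ereal_sup => _ [l' /lub l'l <-]; rewrite lee_fin.
  by apply: ereal_sup_ubound; exists l.
have ub l' : lambda_set f l' -> l' <= l.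
  move=> fl'; rewrite -lee_fin -fl; apply: ereal_sup_ubound; by exists l'.
split=> // xi xiH xi0; have := trnorm_ge0 xi.
rewrite le_eqVlt => /predU1P[<-|xi_gt0]; first by rewrite mulr0 trnorm_ge0.
rewrite -ler_pdivlMr // -lee_fin -fl; apply: ge_ereal_sup => _ [l' fl' <-].
by rewrite lee_fin ler_pdivlMr // fl'.
Qed.

(* Main.v *)
(* Contracting the 2-design identity with a traceless [xi] inverts the
   measurement: [xi = (d + 1) * sum_k tr (xi M_k) P_k].  Since every [P_k] has
   trace norm 1, the triangle inequality gives
   [||xi||_1 <= (d + 1) * sum_k |tr (xi M_k)|], twice as strong as needed.
   The triangle inequality comes from pairing with the partial isometry of the
   polar decomposition of [xi]. *)
Require Import Defs.
From mathcomp Require Import all_boot all_order all_algebra.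
From mathcomp Require Import sesquilinear spectral.
From mathcomp Require Import complex mxtens.
From mathcomp Require Import classical_sets reals ereal.
From mathcomp Require Import lra.
Set Implicit Arguments.
Unset Strict Implicit.
Unset Printing Implicit Defensive.
Import Order.TTheory GRing.Theory Num.Theory.
Local Open Scope ring_scope.
Local Open Scope complex_scope.
Local Open Scope sesquilinear_scope.

Section TraceNorm.
Variable R : realType.
Local Notation C := R[i].

(** * Adjoints and positivity of traces *)

Lemma adjmxM m n q (A : 'M[C]_(m, n)) (B : 'M[C]_(n, q)) :
  (A *m B) ^t* = B ^t* *m A ^t*.
Proof. by rewrite trmx_mul map_mxM. Qed.

Lemma adjmxB m n (A B : 'M[C]_(m, n)) : (A - B) ^t* = A ^t* - B ^t*.
Proof. by rewrite linearB map_mxB. Qed.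

Lemma adjmx1 n : (1%:M : 'M[C]_n) ^t* = 1%:M.
Proof. by rewrite trmx1 map_mx1. Qed.

Lemma adjmxN m n (A : 'M[C]_(m, n)) : (- A) ^t* = - A ^t*.
Proof. by rewrite linearN map_mxN. Qed.

Lemma adjmx_herm n (A : 'M[C]_n) : A \is hermsymmx -> A ^t* = A.
Proof. by move=> /is_hermitianmxP; rewrite expr0 scale1r => <-. Qed.

Lemma mxtrace_adj n (A : 'M[C]_n) : \tr (A ^t*) = (\tr A)^*%C.
Proof. by rewrite /mxtrace rmorph_sum; apply: eq_bigr => k _; rewrite !mxE. Qed.

Lemma Re_conj (z : C) : complex.Re (z^*%C) = complex.Re z.
Proof. by case: z. Qed.

Lemma mxtrace_gram_ge0 m n (A : 'M[C]_(m, n)) : 0 <= \tr (A ^t* *m A).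
Proof.
apply: sumr_ge0 => k _; rewrite mxE; apply: sumr_ge0 => j _.
by rewrite !mxE mulrC mul_conjC_ge0.
Qed.

Lemma Re_ge0 (z : C) : 0 <= z -> 0 <= complex.Re z.
Proof. by rewrite lecE => /andP[]. Qed.

(** * The trace norm as a pairing with isometries *)

Lemma trnormE n (A : 'M[C]_n) :
  trnorm A = complex.Re (\sum_k sqrtC (spectral_diag (A ^t* *m A) 0 k)).
Proof.
rewrite /trnorm /sqrtmx mxtrace_mulC mulmxA mulmxV ?spectral_unit // mul1mx.
by rewrite mxtrace_diag; congr complex.Re; apply: eq_bigr => k _; rewrite mxE.
Qed.

(** A singular value decomposition without its left unitary: in an eigenbasis of the Gram matrix,
    the columns of [A *m V ^t*] are orthogonal and their squared norms are the eigenvalues. *)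
Lemma spectral_gram n (A : 'M[C]_n) :
  let V := spectralmx (A ^t* *m A) in
  (A *m V ^t*) ^t* *m (A *m V ^t*) = diag_mx (spectral_diag (A ^t* *m A)).
Proof.
move=> V; set B := A ^t* *m A.
have Bn : B \is normalmx.
  apply: hermitian_normalmx; apply/is_hermitianmxP; rewrite expr0 scale1r.
  by rewrite adjmxM trmxCK.
have Vu : V \in unitmx by exact: spectral_unit.
have /orthomx_spectralP BE := Bn.
rewrite adjmxM trmxCK mulmxA -(mulmxA V) -/B {1}BE -/V.
rewrite -invmx_unitary ?spectral_unitarymx //.
by rewrite !mulmxA mulmxV // mul1mx mulmxK.
Qed.

(** In the application [E] is the diagonal pseudo-inverse of the singular values and [X] is the
    adjoint of the polar part. *)
Lemma partial_isometry_mx n (V B E : 'M[C]_n) :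
  V *m V ^t* = 1%:M -> E ^t* = E -> E *m (B ^t* *m B) *m E *m E = E ->
  let X := V ^t* *m E *m B ^t* in X *m X ^t* *m X = X.
Proof.
move=> VV EH EBE X; rewrite /X !adjmxM !trmxCK EH.
rewrite -!mulmxA (mulmxA V) VV mul1mx; congr (_ *m _).
by rewrite -[in RHS]EBE -!mulmxA.
Qed.

(** A partial isometry is enough for the later estimates, so the polar part need not be extended to
    a unitary on the kernel of [A]. *)
Lemma trnorm_attained n (A : 'M[C]_n) :
  exists X : 'M[C]_n,
    X *m X ^t* *m X = X /\ complex.Re (\tr (X *m A)) = trnorm A.
Proof.
set V := spectralmx (A ^t* *m A); set D := spectral_diag (A ^t* *m A).
have BD : (A *m V ^t*) ^t* *m (A *m V ^t*) = diag_mx D := spectral_gram A.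
have [B BE] : {B | B = A *m V ^t*} by exists (A *m V ^t*).
rewrite -BE in BD.
have VV : V *m V ^t* = 1%:M by apply/unitarymxP; exact: spectral_unitarymx.
have s0 k : 0 <= sqrtC (D 0 k) by rewrite sqrtC_ge0 spectral_diag_gram_ge0.
(* As 0^-1 = 0, [c] is the pseudo-inverse of the singular values. *)
pose c : 'rV[C]_n := \row_k (sqrtC (D 0 k))^-1.
have cJ : (diag_mx c) ^t* = diag_mx c.
  apply/matrixP => i j; rewrite !mxE eq_sym.
  have [->|_] := eqVneq j i; last by rewrite !mulr0n conjC0.
  by rewrite !mulr1n conj_Creal // ger0_real // invr_ge0.
exists (V ^t* *m diag_mx c *m B ^t*); split.
  apply: partial_isometry_mx => //; rewrite BD !mulmx_diag; congr diag_mx.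
  apply/rowP => k; rewrite !mxE -[X in _ * X / _ / _]sqrtCK.
  have [->|nz] := eqVneq (sqrtC (D 0 k)) 0; first by rewrite invr0 mulr0.
  by rewrite expr2 mulKf // mulfV // mul1r.
(* Cyclicity turns the trace into the sum of [c 0 k * D 0 k], and each term is a singular value. *)
rewrite trnormE -!mulmxA mxtrace_mulC -!mulmxA -BE BD mulmx_diag mxtrace_diag.
congr complex.Re; apply: eq_bigr => k _; rewrite !mxE -/D.
have [nz|nz] := eqVneq (sqrtC (D 0 k)) 0.
  by rewrite nz invr0 mul0r.
by rewrite -[X in _ * X]sqrtCK expr2 mulKf.
Qed.

(** In the eigenbasis of the Gram matrix of [A], column [k] of [X *m A] has the [k]-th singular
    value as its norm, and this norm dominates the diagonal entry. *)
Lemma Re_mxtrace_le_trnorm n (X A : 'M[C]_n) :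
  X ^t* *m X = 1%:M -> complex.Re (\tr (X *m A)) <= trnorm A.
Proof.
move=> XX; set V := spectralmx (A ^t* *m A).
have Vu : V \is unitarymx by exact: spectral_unitarymx.
have VV : V ^t* *m V = 1%:M.
  by rewrite -invmx_unitary // mulVmx // unitarymx_unit.
pose Y := V *m (X *m A) *m V ^t*.
have trY : \tr (X *m A) = \tr Y by rewrite /Y [RHS]mxtrace_mulC mulmxA VV mul1mx.
have YD : Y ^t* *m Y = diag_mx (spectral_diag (A ^t* *m A)).
  rewrite -spectral_gram /Y -/V !adjmxM trmxCK !mulmxA.
  by rewrite -(mulmxA _ _ V) VV mulmx1 -(mulmxA _ _ X) XX mulmx1.
clearbody Y; rewrite trY trnormE -subr_ge0 -raddfB /=.
rewrite /mxtrace -sumrB raddf_sum; apply: sumr_ge0 => k _.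
rewrite raddfB subr_ge0 /=.
set s := sqrtC _.
have s0 : 0 <= s by rewrite sqrtC_ge0 spectral_diag_gram_ge0.
have : `|Y k k| <= s.
  rewrite -(@ler_pXn2r _ 2) ?nnegrE // sqrtCK.
  move/matrixP/(_ k k): YD; rewrite [X in _ = X]mxE eqxx mulr1n => <-.
  rewrite mxE (bigD1 k) //= !mxE -normCKC lerDl.
  by apply: sumr_ge0 => j _; rewrite !mxE mulrC mul_conjC_ge0.
rewrite normc_def lecE /= => /andP[_]; apply: le_trans.
case: (Y k k) => a b /=.
by rewrite (le_trans (ler_norm _)) // -sqrtr_sqr ler_wsqrtr // lerDl sqr_ge0.
Qed.

(** Pairing with [P] is a functional that is nonnegative on Gram matrices, so contractions take
    values at most that of the identity. *)
Lemma Re_mxtrace_projector n (X P : 'M[C]_n) :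
  X *m X ^t* *m X = X -> P ^t* = P -> P *m P = P ->
  `|complex.Re (\tr (X *m P))| <= complex.Re (\tr P).
Proof.
move=> XX PH PP.
pose f (B : 'M[C]_n) := complex.Re (\tr (B *m P)).
have fB A B : f (A - B) = f A - f B by rewrite /f mulmxBl 2!raddfB.
have f1 : f 1%:M = complex.Re (\tr P) by rewrite /f mul1mx.
have fJ A : f (A ^t*) = f A.
  by rewrite /f -Re_conj -mxtrace_adj adjmxM PH trmxCK mxtrace_mulC.
have gP (B : 'M[C]_n) : 0 <= f (B ^t* *m B).
  have := Re_ge0 (mxtrace_gram_ge0 (B *m P)).
  by rewrite adjmxM PH -mulmxA mxtrace_mulC -2!mulmxA PP mulmxA.
have le Z : Z *m Z ^t* *m Z = Z -> f Z <= f 1%:M.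
  (* The first Gram matrix gives [2 * f Z <= f 1 + f (Z ^t* *m Z)]. The second equals the projector
     [1 - Z ^t* *m Z], whence [f (Z ^t* *m Z) <= f 1]. *)
  move=> ZZ; have := gP (1%:M - Z); have := gP (1%:M - Z ^t* *m Z).
  have -> : (1%:M - Z ^t* *m Z) ^t* *m (1%:M - Z ^t* *m Z) =
      1%:M - Z ^t* *m Z.
    rewrite adjmxB adjmx1 adjmxM trmxCK mulmxBr mulmx1 mulmxBl mul1mx.
    by rewrite -(mulmxA (Z ^t*)) (mulmxA Z) ZZ subrr subr0.
  have -> : (1%:M - Z) ^t* *m (1%:M - Z) =
      1%:M - Z ^t* - (Z - Z ^t* *m Z).
    by rewrite adjmxB adjmx1 mulmxBr mulmx1 mulmxBl mul1mx.
  by rewrite !fB fJ; lra.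
rewrite -f1 -/(f X) ler_norml le // andbT lerNl.
have <- : f (- X) = - f X by rewrite /f mulNmx 2!raddfN.
by apply: le; rewrite adjmxN !(mulNmx, mulmxN) !opprK XX.
Qed.

Lemma trnorm_diag_ge n (t : 'I_n -> R) :
  \sum_k `|t k| <= trnorm (\sum_k (t k)%:C *: delta_mx k k : 'M[C]_n).
Proof.
(* The sign at zero is set to 1, which keeps the diagonal test matrix unitary. *)
pose e : 'rV[C]_n := \row_k (if 0 <= t k then 1 else -1).
have eJ : (diag_mx e) ^t* = diag_mx e.
  apply/matrixP => i j; rewrite !mxE eq_sym.
  have [->|_] := eqVneq j i; last by rewrite !mulr0n conjC0.
  by rewrite !mulr1n; case: ifP => _; rewrite ?rmorphN rmorph1.
have ee : (diag_mx e) ^t* *m diag_mx e = 1%:M.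
  rewrite eJ mulmx_diag -diag_const_mx; congr diag_mx; apply/rowP => k.
  by rewrite !mxE; case: ifP => _; rewrite ?mulrNN mulr1.
apply: le_trans (Re_mxtrace_le_trnorm _ ee).
have -> : \sum_k (t k)%:C *: delta_mx k k = diag_mx (\row_k (t k)%:C).
  by rewrite diag_mx_sum_delta; apply: eq_bigr => k _; rewrite mxE.
rewrite mulmx_diag mxtrace_diag raddf_sum /=; apply: ler_sum => k _.
rewrite !mxE; case: ifP => [t0|/negbT]; first by rewrite mul1r ger0_norm.
by rewrite -ltNge => t0; rewrite mulN1r ltr0_norm.
Qed.

(** * Inverting the measurement on traceless operators *)

Lemma swapmxE d (i j k l : 'I_d) :
  swapmx R d (mxtens_index (i, k)) (mxtens_index (j, l)) =
  (i == l)%:R * (k == j)%:R.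
Proof.
rewrite summxE (bigD1 i) //= [X in _ + X]big1 ?addr0; last first.
  move=> a /negPf ai; rewrite summxE big1 // => b _.
  by rewrite tensmxE !mxE eq_sym ai !mul0r.
rewrite summxE (bigD1 j) //= [X in _ + X]big1 ?addr0; last first.
  by move=> b /negPf bj; rewrite tensmxE !mxE [j == b]eq_sym bj andbF mul0r.
by rewrite tensmxE !mxE !eqxx mul1r [l == i]eq_sym -mulnb natrM mulrC.
Qed.

(** Multiply the design identity by [xi] on the first factor and trace that factor out: the identity
    contributes [\tr xi], which is 0, and the swap returns [xi]. Of the normalization [d * d.+1],
    the factor [d] is absorbed by [design_povm]. *)
Lemma design_reconstruct d n (p : 'I_n -> R) (P : 'I_n -> 'M[C]_d)
    (xi : 'M[C]_d) : weighted_2design p P -> \tr xi = 0 ->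
  xi = d.+1%:R *: \sum_k \tr (xi *m design_povm p P k) *: P k.
Proof.
case: d P xi => [|d] P xi [_ _ _ tens] tr0.
  by apply/matrixP => -[].
have nz : d.+1%:R * d.+2%:R != 0 :> C by rewrite mulf_neq0 ?pnatr_eq0.
apply/matrixP => k l.
(* The double sum is the [(k, l)] entry of that partial trace. *)
transitivity (d.+1%:R * d.+2%:R * \sum_i \sum_j xi j i *
   (\sum_m (p m)%:C *: (P m *t P m))
     (mxtens_index (i, k)) (mxtens_index (j, l))); last first.
  rewrite !mxE summxE.
  have -> : \sum_m (\tr (xi *m design_povm p P m) *: P m) k l =
     d.+1%:R * \sum_m (p m)%:C * \tr (xi *m P m) * P m k l.
    rewrite mulr_sumr; apply: eq_bigr => m _.
    by rewrite !mxE -scalemxAr mxtraceZ !mulrA.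
  rewrite mulrA [d.+1%:R * _]mulrC; congr (_ * _).
  under eq_bigr => i _.
    under eq_bigr => j _ do rewrite summxE mulr_sumr.
    rewrite exchange_big; over.
  rewrite exchange_big; apply: eq_bigr => m _.
  rewrite mxtrace_mulC /mxtrace mulr_sumr mulr_suml; apply: eq_bigr => i _.
  rewrite mxE mulr_sumr mulr_suml; apply: eq_bigr => j _.
  rewrite mxE tensmxE !mulrA; congr (_ * _).
  by rewrite [RHS]mulrAC [xi j i * _]mulrC.
rewrite tens.
have E i j : xi j i * ((d.+1%:R * d.+2%:R)^-1 *: (1%:M + swapmx R d.+1))
    (mxtens_index (i, k)) (mxtens_index (j, l)) =
  (d.+1%:R * d.+2%:R)^-1 * (xi j i * (i == j)%:R * (k == l)%:R +
     xi j i * (i == l)%:R * (k == j)%:R).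
  rewrite mxE [X in _ * (_ * X)]mxE swapmxE mxE.
  rewrite (can_eq (@mxtens_indexK _ _)) xpair_eqE -mulnb natrM.
  by rewrite mulrCA; congr (_ * _); rewrite mulrDr !mulrA.
under eq_bigr => i _.
  under eq_bigr => j _ do rewrite E.
  rewrite -mulr_sumr big_split /=; over.
rewrite -mulr_sumr mulVKf // big_split /=.
rewrite [X in X + _](_ : _ = \tr xi * (k == l)%:R); last first.
  rewrite mulr_suml; apply: eq_bigr => i _.
  rewrite (bigD1 i) //= big1 ?addr0 ?eqxx ?mulr1 //.
  by move=> j /negPf ji; rewrite eq_sym ji mulr0 mul0r.
rewrite tr0 mul0r add0r (bigD1 l) //= [X in _ + X]big1 ?addr0; last first.
  by move=> i /negPf il; rewrite big1 // => j _; rewrite il mulr0 mul0r.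
rewrite (bigD1 k) //= big1 ?addr0 ?eqxx ?mulr1 //.
by move=> j /negPf jk; rewrite eq_sym jk mulr0.
Qed.

(** * Traces of projectors and the norm comparison *)

Lemma mxtrace_rank1_projector d (P : 'M[C]_d) :
  rank1_projector P -> \tr P = 1.
Proof.
case=> PH PP rP.
have := mulmx_base P; move: (col_base P) (row_base P) (row_base_free P)
  (col_base_full P).
rewrite rP => c r rf cf cr.
(* In the rank factorization [P = c *m r], idempotence reads [c *m (r *m c) *m r = c *m r]; full
   rank cancels both outer factors. *)
have rc : r *m c = 1%:M.
  apply: (row_full_inj cf); apply: (row_free_inj rf).
  by rewrite mulmx1 mulmxA cr -mulmxA cr.
by rewrite -cr mxtrace_mulC rc mxtrace1.
Qed.

Lemma mxtrace_herm_real d (A B : 'M[C]_d) : A ^t* = A -> B ^t* = B ->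
  \tr (A *m B) = (complex.Re (\tr (A *m B)))%:C.
Proof.
move=> AH BH; have : (\tr (A *m B))^*%C = \tr (A *m B).
  by rewrite -mxtrace_adj adjmxM AH BH mxtrace_mulC.
case: (\tr _) => a b [] /eqP; rewrite eq_sym -addr_eq0 -mulr2n mulrn_eq0 /=.
by move=> /eqP ->.
Qed.

Lemma trnorm_le_measurement d n (p : 'I_n -> R) (P : 'I_n -> 'M[C]_d)
    (xi : 'M[C]_d) : weighted_2design p P -> xi \is hermsymmx -> \tr xi = 0 ->
  trnorm xi <= d.+1%:R * trnorm (measurement (design_povm p P) xi).
Proof.
move=> hP xiH tr0; set M := design_povm p P.
have Pproj k := w2d_proj hP k.
have MH k : (M k) ^t* = M k.
  have [/adjmx_herm PH _ _] := Pproj k.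
  rewrite /M /design_povm linearZ /= map_mxZ PH rmorphM rmorph_nat.
  by congr (_ * _ *: _); exact: conjc_real.
pose t k := complex.Re (\tr (xi *m M k)).
have tE k : \tr (xi *m M k) = (t k)%:C.
  by apply: mxtrace_herm_real => //; exact: adjmx_herm.
have -> : measurement M xi = \sum_k (t k)%:C *: delta_mx k k.
  by apply: eq_bigr => k _; rewrite tE.
apply: le_trans (ler_wpM2l (ler0n _ _) (trnorm_diag_ge t)).
(* One [X], optimal for [xi], is paired with every term of the reconstruction, since the pairing is
   linear. *)
have [X [XX <-]] := trnorm_attained xi.
rewrite {1}(design_reconstruct hP tr0) -scalemxAr mxtraceZ mulmx_sumr.
rewrite raddf_sum mulr_sumr raddf_sum mulr_sumr; apply: ler_sum => k _ /=.
rewrite -/M tE -scalemxAr mxtraceZ.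
have -> : d.+1%:R = (d.+1%:R : R)%:C by rewrite rmorph_nat.
rewrite mulrA -rmorphM /=.
have -> (a : R) (z : C) : complex.Re (a%:C * z) = a * complex.Re z.
  by case: z => x y; rewrite /= mul0r subr0.
(* It remains to bound each pairing of [X] with [P k] by the trace of [P k], which is 1. *)
rewrite -mulrA ler_wpM2l //; apply: le_trans (ler_norm _) _.
rewrite normrM ler_piMr //.
have [/adjmx_herm PH PP _] := Pproj k.
by have := Re_mxtrace_projector XX PH PP; rewrite mxtrace_rank1_projector.
Qed.

End TraceNorm.

Theorem corollary13 (R : realType) (d n : nat) (p : 'I_n -> R)
    (P : 'I_n -> 'M[R[i]]_d) (hP : weighted_2design p P) :
  ((2^-1 * d.+1%:R^-1)%:E <= lambda (measurement (design_povm p P)))%E /\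
  (forall xi : 'M[R[i]]_d, xi \is hermsymmx -> \tr xi = 0 ->
     2^-1 * d.+1%:R^-1 * trnorm xi
       <= trnorm (measurement (design_povm p P) xi)).
Proof.
have H (xi : 'M[R[i]]_d) : xi \is hermsymmx -> \tr xi = 0 ->
     2^-1 * d.+1%:R^-1 * trnorm xi
       <= trnorm (measurement (design_povm p P) xi).
  move=> xiH xi0; have := trnorm_le_measurement hP xiH xi0.
  (* The constant obtained is [d.+1%:R^-1]; the factor 1/2 is then given away. *)
  rewrite -ler_pdivrMl // => le1; apply: le_trans le1.
  rewrite -mulrA ler_piMl ?mulr_ge0 ?trnorm_ge0 ?invr_ge0 ?ler0n //.
  by rewrite invf_le1 ?ler1n.
by split=> //; apply: ereal_sup_ubound; exists (2^-1 * d.+1%:R^-1).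
Qed.
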